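(* The functions $\mathbf{\Phi}_1,\mathbf{\Phi}_2,\mathbf{\Phi}_3$ satisfy the following $q$-differential formulas, where every denominator parameter that occurs is assumed different from $1,q^{-1},q^{-2},\dots$. (i) With $\mathbf{\Phi}_1(x,y)=\mathbf{\Phi}_{1}(q^{\alpha},q^{\beta};q^{\gamma};q,x,y)$, $$\big(q^{\alpha}\mathbf{\Theta}_{x,q}+[\alpha]_{q}\big)\mathbf{\Phi}_{1}(x,y)+q^{\alpha}\mathbf{\Theta}_{y,q}\mathbf{\Phi}_{1}(qx,y)=[\alpha]_{q}\mathbf{\Phi}_{1}(q^{\alpha+1},q^\beta;q^\gamma;q,x,y),$$ $$\big(q^{\alpha}\mathbf{\Theta}_{y,q}+[\alpha]_{q}\big)\mathbf{\Phi}_{1}(x,y)+q^{\alpha}\mathbf{\Theta}_{x,q}\mathbf{\Phi}_{1}(x,qy)=[\alpha]_{q}\mathbf{\Phi}_{1}(q^{\alpha+1},q^\beta;q^\gamma;q,x,y),$$ $$\big(q^{\beta}\mathbf{\Theta}_{x,q}+[\beta]_{q}\big)\mathbf{\Phi}_{1}(x,y)=[\beta]_{q}\mathbf{\Phi}_{1}(q^\alpha,q^{\beta+1};q^\gamma;q,x,y),$$ $$\big(q^{\gamma-1}\mathbf{\Theta}_{x,q}+[\gamma-1]_{q}\big)\mathbf{\Phi}_{1}(x,y)+q^{\gamma-1}\mathbf{\Theta}_{y,q}\mathbf{\Phi}_{1}(qx,y)=[\gamma-1]_{q}\mathbf{\Phi}_{1}(q^\alpha,q^\beta;q^{\gamma-1};q,x,y),$$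 $$\big(q^{\gamma-1}\mathbf{\Theta}_{y,q}+[\gamma-1]_{q}\big)\mathbf{\Phi}_{1}(x,y)+q^{\gamma-1}\mathbf{\Theta}_{x,q}\mathbf{\Phi}_{1}(x,qy)=[\gamma-1]_{q}\mathbf{\Phi}_{1}(q^\alpha,q^\beta;q^{\gamma-1};q,x,y).$$ (ii) With $\mathbf{\Phi}_2(x,y)=\mathbf{\Phi}_{2}(q^{\alpha},q^{\beta};q^{\gamma};q,x,y)$, $$\big(q^{\alpha}\mathbf{\Theta}_{x,q}+[\alpha]_{q}\big)\mathbf{\Phi}_{2}(x,y)=[\alpha]_{q}\mathbf{\Phi}_{2}(q^{\alpha+1},q^\beta;q^\gamma;q,x,y),$$ $$\big(q^{\beta}\mathbf{\Theta}_{y,q}+[\beta]_{q}\big)\mathbf{\Phi}_{2}(x,y)=[\beta]_{q}\mathbf{\Phi}_{2}(q^\alpha,q^{\beta+1};q^\gamma;q,x,y),$$ $$\big(q^{\gamma-1}\mathbf{\Theta}_{x,q}+[\gamma-1]_{q}\big)\mathbf{\Phi}_{2}(x,y)+q^{\gamma-1}\mathbf{\Theta}_{y,q}\mathbf{\Phi}_{2}(qx,y)=[\gamma-1]_{q}\mathbf{\Phi}_{2}(q^\alpha,q^\beta;q^{\gamma-1};q,x,y),$$ $$\big(q^{\gamma-1}\mathbf{\Theta}_{y,q}+[\gamma-1]_{q}\big)\mathbf{\Phi}_{2}(x,y)+q^{\gamma-1}\mathbf{\Theta}_{x,q}\mathbf{\Phi}_{2}(x,qy)=[\gamma-1]_{q}\mathbf{\Phi}_{2}(q^\alpha,q^\beta;q^{\gamma-1};q,x,y).$$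 (iii) With $\mathbf{\Phi}_3(x,y)=\mathbf{\Phi}_{3}(q^{\alpha};q^{\beta};q,x,y)$, $$\big(q^{\alpha}\mathbf{\Theta}_{x,q}+[\alpha]_{q}\big)\mathbf{\Phi}_{3}(x,y)=[\alpha]_{q}\mathbf{\Phi}_{3}(q^{\alpha+1};q^\beta;q,x,y),$$ $$\big(q^{\beta-1}\mathbf{\Theta}_{x,q}+[\beta-1]_{q}\big)\mathbf{\Phi}_{3}(x,y)+q^{\beta-1}\mathbf{\Theta}_{y,q}\mathbf{\Phi}_{3}(qx,y)=[\beta-1]_{q}\mathbf{\Phi}_{3}(q^\alpha;q^{\beta-1};q,x,y),$$ $$\big(q^{\beta-1}\mathbf{\Theta}_{y,q}+[\beta-1]_{q}\big)\mathbf{\Phi}_{3}(x,y)+q^{\beta-1}\mathbf{\Theta}_{x,q}\mathbf{\Phi}_{3}(x,qy)=[\beta-1]_{q}\mathbf{\Phi}_{3}(q^\alpha;q^{\beta-1};q,x,y).$$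
   Context: Let $q\in\mathbb{C}$ with $0<|q|<1$, and put $[z]_q=\frac{1-q^z}{1-q}$. The $q$-shifted factorial is $(a;q)_0=1$, $(a;q)_\ell=\prod_{j=0}^{\ell-1}(1-aq^j)$ for $\ell\ge 1$. The basic Humbert hypergeometric functions are defined by the double series $$\mathbf{\Phi}_{1}(q^{\alpha},q^{\beta};q^{\gamma};q,x,y)=\sum_{n,k=0}^{\infty}\frac{(q^{\alpha};q)_{n+k}(q^{\beta};q)_{n}}{(q^{\gamma};q)_{n+k}(q;q)_{n}(q;q)_{k}}x^{n}y^{k},$$ $$\mathbf{\Phi}_{2}(q^{\alpha},q^{\beta};q^{\gamma};q,x,y)=\sum_{n,k=0}^{\infty}\frac{(q^{\alpha};q)_{n}(q^{\beta};q)_{k}}{(q^{\gamma};q)_{n+k}(q;q)_{n}(q;q)_{k}}x^{n}y^{k},$$ $$\mathbf{\Phi}_{3}(q^{\alpha};q^{\beta};q,x,y)=\sum_{n,k=0}^{\infty}\frac{(q^{\alpha};q)_{n}}{(q^{\beta};q)_{n+k}(q;q)_{n}(q;q)_{k}}x^{n}y^{k},$$ where the denominator parameter ($q^\gamma$ for $\mathbf\Phi_1,\mathbf\Phi_2$; $q^\beta$ for $\mathbf\Phi_3$) is different from $1,q^{-1},q^{-2},\dots$. The operators are $\mathbf{\Theta}_{x,q}=x\mathbb{D}_{x,q}$, $\mathbf{\Theta}_{y,q}=y\mathbb{D}_{y,q}$, where $\mathbb{D}_{z,q}\Psi(z)=\frac{\Psi(z)-\Psi(qz)}{(1-q)z}$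 is the Jackson $q$-difference operator; thus $\mathbf{\Theta}_{x,q}f(x,y)=\frac{f(x,y)-f(qx,y)}{1-q}$ and $\mathbf{\Theta}_{y,q}f(x,y)=\frac{f(x,y)-f(x,qy)}{1-q}$. An expression such as $\mathbf{\Theta}_{y,q}\mathbf{\Phi}_1(qx,y)$ means $\mathbf{\Theta}_{y,q}$ applied to $(x,y)\mapsto\mathbf{\Phi}_1(qx,y)$. *)

(* Defs.v *)
From Stdlib Require Import Reals Lra Lia.
From Coquelicot Require Import Coquelicot.
Open Scope R_scope.

(** * Powers of q *)

Definition Cexp (z : C) : C :=
  (exp (Re z) * cos (Im z), exp (Re z) * sin (Im z)).

(** [q^z] for complex [z] depends on a determination [L] of [log q], i.e. a
    number with [Cexp L = q]; then [q^z] is [exp (z L)]. *)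
Definition qpow (L z : C) : C := Cexp (z * L).

Definition qnum (q L z : C) : C := ((1 - qpow L z) / (1 - q))%C.

(** The q-shifted factorial [(a;q)_n]. *)
Fixpoint qfact (a q : C) (n : nat) : C :=
  match n with
  | O => 1%C
  | S m => (qfact a q m * (1 - a * q ^ m))%C
  end.

(** [c] is none of [1, q^-1, q^-2, ...]. *)
Definition admissible (q c : C) : Prop := forall n : nat, c <> (/ q ^ n)%C.

(** * Double series *)

Definition dpartial (a : nat -> nat -> C) (p : nat * nat) : C :=
  sum_n (fun n => sum_n (a n) (snd p)) (fst p).

(** Convergence of the rectangular partial sums as both bounds go to infinity
    independently. *)
Definition is_dsum (a : nat -> nat -> C) (s : C) : Prop :=
  filterlim (dpartial a) (filter_prod eventually eventually) (locally s).

Definition abs_summable (a : nat -> nat -> C) : Prop :=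
  exists M : R, forall N K : nat,
    sum_n (fun n => sum_n (fun k => Cmod (a n k)) K) N <= M.

(** The sum of a double series; it has no meaning if the series diverges. *)
Definition dsum (a : nat -> nat -> C) : C :=
  C_complete_lim (filtermap (dpartial a) (filter_prod eventually eventually)).

(** * The basic Humbert functions

    As in the notation [Phi1(q^alpha, q^beta; q^gamma; q, x, y)], the parameters
    [a], [b], [c] stand for the powers of [q] and not for the exponents. *)

Definition Phi1_term (a b c q x y : C) (n k : nat) : C :=
  (qfact a q (n + k) * qfact b q n
     / (qfact c q (n + k) * qfact q q n * qfact q q k) * x ^ n * y ^ k)%C.

Definition Phi2_term (a b c q x y : C) (n k : nat) : C :=
  (qfact a q n * qfact b q k
     / (qfact c q (n + k) * qfact q q n * qfact q q k) * x ^ n * y ^ k)%C.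

Definition Phi3_term (a b q x y : C) (n k : nat) : C :=
  (qfact a q n
     / (qfact b q (n + k) * qfact q q n * qfact q q k) * x ^ n * y ^ k)%C.

Definition Phi1 (a b c q x y : C) : C := dsum (Phi1_term a b c q x y).
Definition Phi2 (a b c q x y : C) : C := dsum (Phi2_term a b c q x y).
Definition Phi3 (a b q x y : C) : C := dsum (Phi3_term a b q x y).

(** * Jackson q-difference operators *)

Definition jackson (q : C) (Psi : C -> C) (z : C) : C :=
  ((Psi z - Psi (q * z)) / ((1 - q) * z))%C.

Definition Theta_x (q : C) (f : C -> C -> C) (x y : C) : C :=
  (x * jackson q (fun t => f t y) x)%C.

Definition Theta_y (q : C) (f : C -> C -> C) (x y : C) : C :=
  (y * jackson q (fun t => f x t) y)%C.

(** The closed forms hold at [x = 0] and [y = 0] too. *)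

Lemma C1_minus_neq0 (q : C) : Cmod q < 1 -> (1 - q <> 0)%C.
Proof.
intros Hq H.
assert (q = 1%C) as E.
{ replace q with (1 - (1 - q))%C by ring. rewrite H. ring. }
rewrite E, Cmod_1 in Hq. lra.
Qed.

Lemma theta_closed (q u : C) (Psi : C -> C) : Cmod q < 1 ->
  (u * jackson q Psi u = (Psi u - Psi (q * u)) / (1 - q))%C.
Proof.
intros Hq. pose proof (C1_minus_neq0 q Hq) as H1. unfold jackson.
destruct (Ceq_dec u 0) as [->|Hu].
- rewrite Cmult_0_r. unfold Cdiv. ring.
- field. auto.
Qed.

Lemma Theta_xE (q : C) (f : C -> C -> C) (x y : C) : Cmod q < 1 ->
  Theta_x q f x y = ((f x y - f (q * x) y) / (1 - q))%C.
Proof. exact (theta_closed q x (fun t => f t y)). Qed.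

Lemma Theta_yE (q : C) (f : C -> C -> C) (x y : C) : Cmod q < 1 ->
  Theta_y q f x y = ((f x y - f x (q * y)) / (1 - q))%C.
Proof. exact (theta_closed q y (f x)). Qed.

(** * [dsum] is the sum of a convergent series *)

Lemma dsum_unique (a : nat -> nat -> C) (s : C) : is_dsum a s -> dsum a = s.
Proof.
intros H.
set (F := filter_prod (@eventually) (@eventually)) in *.
assert (HF : ProperFilter F) by apply filter_prod_proper.
assert (Hl : filterlim (dpartial a) F (locally (dsum a))).
{ intros P [eps HP].
  assert (PF : ProperFilter (filtermap (dpartial a) F))
    by (apply filtermap_proper_filter; exact HF).
  generalize (C_complete_ax1 _ PF
    (fun e => ex_intro _ s (H _ (locally_ball s e))) eps).
  unfold filtermap; apply filter_imp; intros p; apply HP. }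
exact (filterlim_locally_unique (K := C_AbsRing) (V := C_NormedModule)
  (dpartial a) (dsum a) s Hl H).
Qed.

(** * Absolute convergence on the unit bidisc *)

Lemma prod_bound (P u : nat -> R) (K r : R) : 0 <= r < 1 -> 0 <= K ->
  P O = 1 -> (forall n, P (S n) = P n * u n) ->
  (forall n, 0 <= u n <= 1 + K * r ^ n) ->
  forall n, 0 <= P n <= exp (K / (1 - r)).
Proof.
intros Hr HK P0 PS Hu.
assert (H : forall n, 0 <= P n <= exp (K / (1 - r) * (1 - r ^ n))).
{ induction n as [|n IH].
  - rewrite P0. simpl. rewrite Rminus_diag, Rmult_0_r, exp_0. lra.
  - rewrite PS.
    replace (K / (1 - r) * (1 - r ^ S n))
      with (K / (1 - r) * (1 - r ^ n) + K * r ^ n)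
      by (simpl; field; lra).
    rewrite exp_plus. specialize (Hu n).
    pose proof (exp_ineq1_le (K * r ^ n)) as He.
    split.
    + apply Rmult_le_pos; lra.
    + apply Rmult_le_compat; lra. }
intros n. destruct (H n) as [H0 H1]. split; [exact H0|].
apply Rle_trans with (1 := H1).
assert (0 <= K / (1 - r)) by (apply Rdiv_le_0_compat; lra).
assert (0 <= r ^ n) by (apply pow_le; lra).
assert (HL : K / (1 - r) * (1 - r ^ n) <= K / (1 - r)) by nra.
destruct HL as [HL|HL].
- left. now apply exp_increasing.
- rewrite HL. lra.
Qed.

Lemma Cmod_cq (c q : C) (j : nat) : Cmod (c * q ^ j) = Cmod c * Cmod q ^ j.
Proof. now rewrite Cmod_mult, Cmod_pow. Qed.

Lemma qfact_bounded (a q : C) : Cmod q < 1 ->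
  exists A, forall n, Cmod (qfact a q n) <= A.
Proof.
intros Hq. exists (exp (Cmod a / (1 - Cmod q))). intros n.
apply (prod_bound (fun n => Cmod (qfact a q n))
         (fun n => Cmod (1 - a * q ^ n)) (Cmod a) (Cmod q)).
- split; [apply Cmod_ge_0|exact Hq].
- apply Cmod_ge_0.
- apply Cmod_1.
- intros m. simpl. apply Cmod_mult.
- intros m. split; [apply Cmod_ge_0|].
  pose proof (Cmod_triangle 1 (- (a * q ^ m))) as H.
  rewrite Cmod_1, Cmod_opp, Cmod_cq in H. exact H.
Qed.

Lemma Cmod_1_minus (u : C) : 1 - Cmod u <= Cmod (1 - u).
Proof.
pose proof (Cmod_triangle (1 - u) u) as H.
replace (1 - u + u)%C with (RtoC 1) in H by ring.
rewrite Cmod_1 in H. lra.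
Qed.

Lemma admissible_neq0 (q c : C) : q <> 0%C -> admissible q c ->
  forall n, (1 - c * q ^ n <> 0)%C.
Proof.
intros Hq Hc n H. apply (Hc n).
assert (Hn : (q ^ n <> 0)%C) by now apply Cpow_nz.
replace c with ((1 - (1 - c * q ^ n)) / q ^ n)%C by (field; exact Hn).
rewrite H. field. exact Hn.
Qed.

Lemma factor_inv_bounded (q c : C) : 0 < Cmod q < 1 -> admissible q c ->
  exists B, 0 <= B /\ forall n, / Cmod (1 - c * q ^ n) <= B.
Proof.
intros Hq Hc.
assert (q0 : q <> 0%C) by (apply Cmod_gt_0; lra).
assert (Hpos : forall n, 0 < / Cmod (1 - c * q ^ n)).
{ intros n. apply Rinv_0_lt_compat, Cmod_gt_0. now apply admissible_neq0. }
assert (HJ : exists J, forall n, (J <= n)%nat -> / Cmod (1 - c * q ^ n) <= 2).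
{ pose proof (Cmod_ge_0 c) as Hc0.
  destruct (pow_lt_1_zero (Cmod q) ltac:(rewrite Rabs_pos_eq; lra)
              (/ (2 * (Cmod c + 1)))) as [J HJ].
  { apply Rinv_0_lt_compat. lra. }
  exists J. intros n Hn. specialize (HJ n Hn).
  rewrite Rabs_pos_eq in HJ by (apply pow_le; lra).
  assert (Hle : / 2 <= Cmod (1 - c * q ^ n)).
  { eapply Rle_trans; [|apply Cmod_1_minus]. rewrite Cmod_cq.
    assert (Cmod c * Cmod q ^ n <= Cmod c * / (2 * (Cmod c + 1)))
      by (apply Rmult_le_compat_l; lra).
    assert (Cmod c * / (2 * (Cmod c + 1)) <= / 2); [|lra].
    apply Rmult_le_reg_r with (2 * (Cmod c + 1)); [lra|].
    field_simplify; lra. }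
  replace 2 with (/ / 2) by lra. apply Rinv_le_contravar; lra. }
destruct HJ as [J HJ].
assert (HB : forall m, exists B, 0 <= B /\
          forall n, (n < m)%nat -> / Cmod (1 - c * q ^ n) <= B).
{ induction m as [|m [B [HB0 HB]]].
  - exists 0. split; [lra|]. intros; lia.
  - exists (B + / Cmod (1 - c * q ^ m)). specialize (Hpos m) as Hm.
    split; [lra|]. intros n Hn.
    destruct (Nat.eq_dec n m) as [->|Hnm]; [lra|].
    specialize (HB n ltac:(lia)). lra. }
destruct (HB J) as [B [HB0 HB1]].
exists (B + 2). split; [lra|]. intros n.
destruct (Nat.le_gt_cases J n) as [Hn|Hn].
- specialize (HJ n Hn). lra.
- specialize (HB1 n Hn). lra.
Qed.

Lemma qfact_inv_bounded (c q : C) : 0 < Cmod q < 1 -> admissible q c ->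
  exists B, forall n, (qfact c q n <> 0)%C /\ / Cmod (qfact c q n) <= B.
Proof.
intros Hq Hc.
assert (q0 : q <> 0%C) by (apply Cmod_gt_0; lra).
pose proof (admissible_neq0 q c q0 Hc) as Hf.
destruct (factor_inv_bounded q c Hq Hc) as [B [HB0 HB]].
exists (exp (B * Cmod c / (1 - Cmod q))). intros n. split.
- induction n as [|n IH]; simpl; [exact C1_nz|]. now apply Cmult_neq_0.
- apply (prod_bound (fun n => / Cmod (qfact c q n))
           (fun n => / Cmod (1 - c * q ^ n)) (B * Cmod c) (Cmod q)).
  + lra.
  + apply Rmult_le_pos; [exact HB0|apply Cmod_ge_0].
  + simpl. rewrite Cmod_1. apply Rinv_1.
  + intros m. simpl. rewrite Cmod_mult. apply Rinv_mult.
  + intros m. specialize (Hf m). specialize (HB m).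
    apply Cmod_gt_0 in Hf. pose proof (Rinv_0_lt_compat _ Hf) as Hi.
    split; [lra|].
    pose proof (Cmod_1_minus (c * q ^ m)) as H1. rewrite Cmod_cq in H1.
    set (v := Cmod (1 - c * q ^ m)) in *. set (w := Cmod c * Cmod q ^ m) in *.
    assert (0 <= w)
      by (apply Rmult_le_pos; [apply Cmod_ge_0|apply pow_le; lra]).
    replace (B * Cmod c * Cmod q ^ m) with (B * w) by (unfold w; ring).
    assert (Hv : / v * v = 1) by (field; lra).
    nra.
Qed.

Lemma admissible_q (q : C) : 0 < Cmod q < 1 -> admissible q q.
Proof.
intros Hq n H.
assert (q0 : q <> 0%C) by (apply Cmod_gt_0; lra).
assert (E : (q ^ S n = 1)%C).
{ simpl. rewrite H at 1. field. now apply Cpow_nz. }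
apply (f_equal Cmod) in E. rewrite Cmod_pow, Cmod_1 in E.
pose proof (pow_lt_1_compat (Cmod q) (S n) ltac:(lra) ltac:(lia)). lra.
Qed.

Lemma geom_bound (r : R) (N : nat) : 0 <= r < 1 ->
  sum_n (fun n => r ^ n) N <= / (1 - r).
Proof.
intros Hr. rewrite sum_n_Reals, tech3 by lra.
assert (0 <= r ^ S N) by (apply pow_le; lra).
unfold Rdiv. rewrite <- (Rmult_1_l (/ (1 - r))) at 2.
apply Rmult_le_compat_r; [|lra].
left. apply Rinv_0_lt_compat. lra.
Qed.

Lemma abs_summable_geom (a : nat -> nat -> C) (M : R) (x y : C) :
  Cmod x < 1 -> Cmod y < 1 ->
  (forall n k, Cmod (a n k) <= M * Cmod x ^ n * Cmod y ^ k) -> abs_summable a.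
Proof.
intros Hx Hy Ha.
pose proof (Cmod_ge_0 x) as x0. pose proof (Cmod_ge_0 y) as y0.
assert (M0 : 0 <= M).
{ generalize (Ha O O) (Cmod_ge_0 (a O O)). simpl. lra. }
exists (M * / (1 - Cmod y) * / (1 - Cmod x)). intros N K.
apply Rle_trans
  with (sum_n (fun n => M * / (1 - Cmod y) * Cmod x ^ n) N).
- apply sum_n_m_le. intros n.
  apply Rle_trans with (sum_n (fun k => M * Cmod x ^ n * Cmod y ^ k) K).
  + apply sum_n_m_le. intros k. apply Ha.
  + rewrite (sum_n_mult_l (K := R_Ring)).
    replace (M * / (1 - Cmod y) * Cmod x ^ n)
      with (M * Cmod x ^ n * / (1 - Cmod y)) by ring.
    apply Rmult_le_compat_l; [|now apply geom_bound].
    apply Rmult_le_pos; [exact M0|now apply pow_le].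
- rewrite (sum_n_mult_l (K := R_Ring)).
  apply Rmult_le_compat_l; [|now apply geom_bound].
  apply Rmult_le_pos; [exact M0|].
  left. apply Rinv_0_lt_compat. lra.
Qed.

Lemma abs_summable_quot (q c x y : C) (N : nat -> nat -> C) (A : R) :
  0 < Cmod q < 1 -> admissible q c -> Cmod x < 1 -> Cmod y < 1 ->
  (forall n k, Cmod (N n k) <= A) ->
  abs_summable (fun n k =>
    (N n k / (qfact c q (n + k) * qfact q q n * qfact q q k)
       * x ^ n * y ^ k)%C).
Proof.
intros Hq Hc Hx Hy HN.
destruct (qfact_inv_bounded c q Hq Hc) as [B HB].
destruct (qfact_inv_bounded q q Hq (admissible_q q Hq)) as [D HD].
apply abs_summable_geom with (M := A * (B * D * D)) (x := x) (y := y); auto.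
intros n k.
destruct (HB (n + k)%nat) as [h1 b1]. destruct (HD n) as [h2 b2].
destruct (HD k) as [h3 b3].
rewrite !Cmod_mult, !Cmod_pow.
apply Rmult_le_compat_r; [apply pow_le, Cmod_ge_0|].
apply Rmult_le_compat_r; [apply pow_le, Cmod_ge_0|].
rewrite Cmod_div by (repeat apply Cmult_neq_0; assumption).
rewrite !Cmod_mult. unfold Rdiv. rewrite !Rinv_mult.
apply Cmod_gt_0, Rinv_0_lt_compat in h1.
apply Cmod_gt_0, Rinv_0_lt_compat in h2.
apply Cmod_gt_0, Rinv_0_lt_compat in h3.
apply Rmult_le_compat; auto.
- apply Cmod_ge_0.
- repeat apply Rmult_le_pos; lra.
- apply Rmult_le_compat; try lra.
  + apply Rmult_le_pos; lra.
  + apply Rmult_le_compat; lra.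
Qed.

Lemma Cmod_mult_bounded (u v : C) (A B : R) :
  Cmod u <= A -> Cmod v <= B -> Cmod (u * v) <= A * B.
Proof.
intros Hu Hv. rewrite Cmod_mult.
apply Rmult_le_compat; auto using Cmod_ge_0.
Qed.

Lemma Phi1_abs_summable (a b c q x y : C) : 0 < Cmod q < 1 ->
  admissible q c -> Cmod x < 1 -> Cmod y < 1 ->
  abs_summable (Phi1_term a b c q x y).
Proof.
intros Hq Hc Hx Hy.
destruct (qfact_bounded a q (proj2 Hq)) as [A HA].
destruct (qfact_bounded b q (proj2 Hq)) as [B HB].
apply (abs_summable_quot q c x y
         (fun n k => (qfact a q (n + k) * qfact b q n)%C) (A * B)); auto.
intros; now apply Cmod_mult_bounded.
Qed.

Lemma Phi2_abs_summable (a b c q x y : C) : 0 < Cmod q < 1 ->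
  admissible q c -> Cmod x < 1 -> Cmod y < 1 ->
  abs_summable (Phi2_term a b c q x y).
Proof.
intros Hq Hc Hx Hy.
destruct (qfact_bounded a q (proj2 Hq)) as [A HA].
destruct (qfact_bounded b q (proj2 Hq)) as [B HB].
apply (abs_summable_quot q c x y
         (fun n k => (qfact a q n * qfact b q k)%C) (A * B)); auto.
intros; now apply Cmod_mult_bounded.
Qed.

Lemma Phi3_abs_summable (a b q x y : C) : 0 < Cmod q < 1 ->
  admissible q b -> Cmod x < 1 -> Cmod y < 1 ->
  abs_summable (Phi3_term a b q x y).
Proof.
intros Hq Hb Hx Hy.
destruct (qfact_bounded a q (proj2 Hq)) as [A HA].
apply (abs_summable_quot q b x y (fun n _ => qfact a q n) A); auto.
Qed.

(* Main.v *)
(* Every term of a Humbert series is [c n k x^n y^k], so the dilation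
   [(x,y) -> (u x, v y)] multiplies the (n,k) term by [u^n v^k].  The left-hand
   sides telescope to [(F(x,y) - a F(u x, v y)) / (1 - q)] with [(u,v)] one of
   [(q,1)], [(1,q)], [(q,q)], i.e. to the series with coefficients
   [(1 - a u^n v^k) c n k / (1 - q)].  The contiguity relations
   [(1 - a)(aq;q)_m = (1 - a q^m)(a;q)_m] recognise this as [(1 - a) / (1 - q)]
   times the series with shifted parameter. *)
Require Import Defs.
From Stdlib Require Import Reals Lra Lia.
From Coquelicot Require Import Coquelicot.
Open Scope R_scope.

(** * Double series *)

Definition dpartialR (a : nat -> nat -> C) (N K : nat) : R :=
  sum_n (fun n => sum_n (fun k => Cmod (a n k)) K) N.

Lemma Cmod_sum_n (a : nat -> C) (N : nat) :
  Cmod (sum_n a N) <= sum_n (fun n => Cmod (a n)) N.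
Proof.
exact (norm_sum_n_m (K := C_AbsRing) (V := C_NormedModule) a 0 N).
Qed.

(** The rectangle grows strip by strip: first [j] columns at height [N], then [i] rows of full width
    [K + j]. By the triangle inequality each strip changes the complex sum by at most what it adds
    to the sum of moduli. *)
Lemma dpartial_diff (a : nat -> nat -> C) (N K i j : nat) :
  Cmod (dpartial a (N + i, K + j)%nat - dpartial a (N, K))
    <= dpartialR a (N + i) (K + j) - dpartialR a N K.
Proof.
induction i as [|i IH].
- rewrite Nat.add_0_r. induction j as [|j IH].
  + rewrite Nat.add_0_r.
    replace (dpartial a (N, K) - dpartial a (N, K))%C with (RtoC 0) by ring.
    rewrite Cmod_0. lra.
  + assert (E : dpartial a (N, K + S j)%nat
      = (dpartial a (N, K + j)%nat + sum_n (fun n => a n (S (K + j))) N)%C).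
    { unfold dpartial; simpl. rewrite Nat.add_succ_r.
      etransitivity; [apply sum_n_ext; intros; apply sum_Sn|].
      apply (sum_n_plus (G := C_AbelianMonoid)). }
    assert (E' : dpartialR a N (K + S j)
      = dpartialR a N (K + j) + sum_n (fun n => Cmod (a n (S (K + j)))) N).
    { unfold dpartialR. rewrite Nat.add_succ_r.
      etransitivity; [apply sum_n_ext; intros; apply sum_Sn|].
      apply (sum_n_plus (G := R_AbelianMonoid)). }
    rewrite E, E'.
    pose proof (Cmod_sum_n (fun n => a n (S (K + j))) N) as H.
    pose proof (Cmod_triangle (dpartial a (N, K + j)%nat - dpartial a (N, K))
      (sum_n (fun n => a n (S (K + j))) N)) as H'.
    match type of H' with Cmod ?u <= _ => match goal with
      |- Cmod ?v <= _ => replace v with u by ring end end.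
    lra.
- rewrite Nat.add_succ_r.
  assert (E : dpartial a (S (N + i), K + j)%nat
    = (dpartial a (N + i, K + j)%nat + sum_n (a (S (N + i))) (K + j))%C)
    by apply (sum_Sn (G := C_AbelianMonoid)).
  assert (E' : dpartialR a (S (N + i)) (K + j)
    = dpartialR a (N + i) (K + j)
      + sum_n (fun k => Cmod (a (S (N + i)) k)) (K + j))
    by apply (sum_Sn (G := R_AbelianMonoid)).
  rewrite E, E'.
  pose proof (Cmod_sum_n (a (S (N + i))) (K + j)) as H.
  pose proof (Cmod_triangle
    (dpartial a (N + i, K + j)%nat - dpartial a (N, K))
    (sum_n (a (S (N + i))) (K + j))) as H'.
  match type of H' with Cmod ?u <= _ => match goal with
    |- Cmod ?v <= _ => replace v with u by ring end end.
  lra.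
Qed.

(** Cauchy criterion: the sums of moduli have a supremum, and once a rectangle comes within [eps] of
    it, no larger rectangle can move the partial sum by [eps]. *)
Lemma abs_summable_is_dsum (a : nat -> nat -> C) :
  abs_summable a -> is_dsum a (dsum a).
Proof.
intros [M HM].
destruct (completeness (fun r => exists N K, r = dpartialR a N K)) as [s [Hub Hlub]].
{ exists M. intros r (N & K & ->). apply HM. }
{ exists (dpartialR a 0 0). now exists O, O. }
assert (HF : ProperFilter (filter_prod (@eventually) (@eventually)))
  by apply filter_prod_proper.
unfold is_dsum. intros P [eps HP].
(* [dsum] is the limit that completeness assigns to this filter, so it remains to find, for each
   [eps], a ball of that radius containing the partial sums eventually. *)
pose proof (C_complete_ax1 _ (filtermap_proper_filter _ _ (dpartial a) _ HF)) as H.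
cut (filtermap (dpartial a) (filter_prod eventually eventually)
  (ball (dsum a) eps)).
{ unfold filtermap. apply filter_imp. intros p. apply HP. }
apply H. clear eps P HP H. intros eps.
assert (HNK : exists N K, s - eps < dpartialR a N K).
(* Otherwise [s - eps] would be an upper bound smaller than the supremum [s]. *)
{ apply Classical_Prop.NNPP. intros Hn.
  assert (s <= s - eps); [|pose proof (cond_pos eps); lra].
  apply Hlub. intros r (N & K & ->). apply Rnot_lt_le. intros Hlt.
  apply Hn. now exists N, K. }
destruct HNK as (N & K & HNK).
exists (dpartial a (N, K)).
exists (fun n => (N <= n)%nat) (fun k => (K <= k)%nat);
  [now exists N|now exists K|].
intros n k Hn Hk. apply C_NormedModule_mixin_compat1.
pose proof (dpartial_diff a N K (n - N) (k - K)) as Hd.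
replace (N + (n - N))%nat with n in Hd by lia.
replace (K + (k - K))%nat with k in Hd by lia.
assert (dpartialR a n k <= s) by (apply Hub; now exists n, k).
unfold minus, plus, opp; simpl. unfold Cminus in Hd. lra.
Qed.

Lemma abs_summable_le (a b : nat -> nat -> C) :
  (forall n k, Cmod (b n k) <= Cmod (a n k)) ->
  abs_summable a -> abs_summable b.
Proof.
intros Hab [M HM]. exists M. intros N K.
apply Rle_trans with (2 := HM N K).
apply sum_n_m_le. intros n. apply sum_n_m_le. intros k. apply Hab.
Qed.

Lemma is_dsum_ext (a b : nat -> nat -> C) (s : C) :
  (forall n k, a n k = b n k) -> is_dsum a s -> is_dsum b s.
Proof.
intros Hab. apply filterlim_ext. intros p.
apply sum_n_ext. intros n. apply sum_n_ext. intros k. apply Hab.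
Qed.

Lemma is_dsum_plus (a b : nat -> nat -> C) (s t : C) :
  is_dsum a s -> is_dsum b t -> is_dsum (fun n k => a n k + b n k)%C (s + t)%C.
Proof.
intros Ha Hb. unfold is_dsum.
apply filterlim_ext with (fun p => plus (dpartial a p) (dpartial b p)).
- intros p. symmetry. unfold dpartial.
  etransitivity;
    [apply sum_n_ext; intros; apply (sum_n_plus (G := C_AbelianMonoid))|].
  apply (sum_n_plus (G := C_AbelianMonoid)).
- apply filterlim_comp_2 with (1 := Ha) (2 := Hb).
  exact (filterlim_plus (K := C_AbsRing) (V := C_NormedModule) s t).
Qed.

Lemma is_dsum_scal (w : C) (a : nat -> nat -> C) (s : C) :
  is_dsum a s -> is_dsum (fun n k => w * a n k)%C (w * s)%C.
Proof.
intros Ha. unfold is_dsum.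
apply filterlim_ext with (fun p => mult w (dpartial a p)).
- intros p. symmetry. unfold dpartial.
  etransitivity;
    [apply sum_n_ext; intros; apply (sum_n_mult_l (K := C_Ring))|].
  apply (sum_n_mult_l (K := C_Ring)).
- apply filterlim_comp with (1 := Ha).
  exact (filterlim_scal_r (K := C_AbsRing) (V := C_NormedModule) w s).
Qed.

(* For [w = 0] the series [t] may diverge, but then [w * dsum t] is [0]
   whatever [dsum t] is. *)
Lemma is_dsum_scal_inv (w s : C) (u t : nat -> nat -> C) :
  (forall n k, u n k = w * t n k)%C -> is_dsum u s -> (s = w * dsum t)%C.
Proof.
intros Hut Hu. destruct (Ceq_dec w 0) as [->|Hw].
- rewrite Cmult_0_l, <- (dsum_unique u s Hu). apply dsum_unique.
  rewrite <- (Cmult_0_l s). apply (is_dsum_ext (fun n k => 0 * u n k)%C).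
  + intros n k. rewrite Hut. ring.
  + now apply is_dsum_scal.
- rewrite (dsum_unique t (/ w * s)%C).
  + now field.
  + apply (is_dsum_ext (fun n k => / w * u n k)%C).
    * intros n k. rewrite Hut. now field.
    * now apply is_dsum_scal.
Qed.

(** * Dilations of a double power series *)

Definition pterm (c : nat -> nat -> C) (x y : C) (n k : nat) : C :=
  (c n k * x ^ n * y ^ k)%C.

(** Since [u] and [v] lie in the closed unit disc, the dilated series is dominated by the original
    one. Both sums can then be combined term by term. *)
Lemma dsum_dilation (c c' : nat -> nat -> C) (a u v x y : C) :
  Cmod u <= 1 -> Cmod v <= 1 -> abs_summable (pterm c x y) ->
  (forall n k, (1 - a * (u ^ n * v ^ k)) * c n k = (1 - a) * c' n k)%C ->
  (dsum (pterm c x y) - a * dsum (pterm c (u * x) (v * y))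
   = (1 - a) * dsum (pterm c' x y))%C.
Proof.
intros Hu Hv Hs Hc.
assert (E : forall n k,
  pterm c (u * x) (v * y) n k = (u ^ n * v ^ k * pterm c x y n k)%C).
{ intros n k. unfold pterm. rewrite !Cpow_mult_l. ring. }
assert (Hd : abs_summable (pterm c (u * x) (v * y))).
{ apply abs_summable_le with (2 := Hs). intros n k.
  rewrite E, !Cmod_mult, !Cmod_pow.
  assert (H : forall z m, Cmod z <= 1 -> 0 <= Cmod z ^ m <= 1).
  { intros z m Hz. split; [apply pow_le, Cmod_ge_0|].
    rewrite <- (pow1 m). apply pow_incr. split; [apply Cmod_ge_0|exact Hz]. }
  pose proof (H u n Hu). pose proof (H v k Hv).
  pose proof (Cmod_ge_0 (pterm c x y n k)).
  rewrite <- (Rmult_1_l (Cmod (pterm c x y n k))) at 2.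
  apply Rmult_le_compat_r; [assumption|nra]. }
(* Convergence is known for the combined series on the left; the sum with coefficients [c'] is
   recovered from it, the case [1 - a = 0] included. *)
apply is_dsum_scal_inv with
  (u := fun n k => (pterm c x y n k + - a * pterm c (u * x) (v * y) n k)%C).
- intros n k. rewrite E. unfold pterm.
  transitivity ((1 - a * (u ^ n * v ^ k)) * c n k * x ^ n * y ^ k)%C; [ring|].
  rewrite Hc. ring.
- replace (dsum (pterm c x y) - a * dsum (pterm c (u * x) (v * y)))%C
    with (dsum (pterm c x y) + - a * dsum (pterm c (u * x) (v * y)))%C by ring.
  apply is_dsum_plus; [|apply is_dsum_scal]; now apply abs_summable_is_dsum.
Qed.

(** * Contiguity relations for a general coefficient array *)

Section Contiguity.

Variables (q a x y : C) (c c' : nat -> nat -> C).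
Hypothesis Hq : Cmod q < 1.
Hypothesis Hs : abs_summable (pterm c x y).

Let F (s t : C) : C := dsum (pterm c s t).
Let G : C := dsum (pterm c' x y).

(** The terms in [F x y] add up to [F x y / (1 - q)], because [a + (1 - a) = 1]; what remains is the
    dilation with [u = q], [v = 1]. *)
Lemma contiguity_x :
  (forall n k, (1 - a * q ^ n) * c n k = (1 - a) * c' n k)%C ->
  (a * Theta_x q F x y + (1 - a) / (1 - q) * F x y = (1 - a) / (1 - q) * G)%C.
Proof.
intros Hc. pose proof (C1_minus_neq0 q Hq) as H1. rewrite Theta_xE by exact Hq.
assert (D : (F x y - a * F (q * x) (1 * y) = (1 - a) * G)%C).
{ apply dsum_dilation; [lra|rewrite Cmod_1; lra|exact Hs|].
  intros n k. rewrite <- Hc, Cpow_1_l. ring. }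
rewrite Cmult_1_l in D.
transitivity ((F x y - a * F (q * x)%C y) / (1 - q))%C; [now field|].
rewrite D. now field.
Qed.

Lemma contiguity_y :
  (forall n k, (1 - a * q ^ k) * c n k = (1 - a) * c' n k)%C ->
  (a * Theta_y q F x y + (1 - a) / (1 - q) * F x y = (1 - a) / (1 - q) * G)%C.
Proof.
intros Hc. pose proof (C1_minus_neq0 q Hq) as H1. rewrite Theta_yE by exact Hq.
assert (D : (F x y - a * F (1 * x) (q * y) = (1 - a) * G)%C).
{ apply dsum_dilation; [rewrite Cmod_1; lra|lra|exact Hs|].
  intros n k. rewrite <- Hc, Cpow_1_l. ring. }
rewrite Cmult_1_l in D.
transitivity ((F x y - a * F x (q * y)%C) / (1 - q))%C; [now field|].
rewrite D. now field.
Qed.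

(** In the first formula the second operator supplies [a * F (q * x) y / (1 - q)], which cancels the
    same term of [Theta_x]; in the second formula [F x (q * y)] cancels likewise. Both leave the
    dilation with [u = v = q]. *)
Lemma contiguity_xy :
  (forall n k, (1 - a * q ^ (n + k)) * c n k = (1 - a) * c' n k)%C ->
  (a * Theta_x q F x y + (1 - a) / (1 - q) * F x y
     + a * Theta_y q (fun s t => F (q * s) t) x y
   = (1 - a) / (1 - q) * G)%C /\
  (a * Theta_y q F x y + (1 - a) / (1 - q) * F x y
     + a * Theta_x q (fun s t => F s (q * t)) x y
   = (1 - a) / (1 - q) * G)%C.
Proof.
intros Hc. pose proof (C1_minus_neq0 q Hq) as H1.
rewrite !Theta_xE, !Theta_yE by exact Hq.
assert (D : (F x y - a * F (q * x) (q * y) = (1 - a) * G)%C).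
{ apply dsum_dilation; [lra|lra|exact Hs|].
  intros n k. now rewrite <- Hc, Cpow_add_r. }
split;
  (transitivity ((F x y - a * F (q * x)%C (q * y)%C) / (1 - q))%C;
    [now field|rewrite D; now field]).
Qed.

End Contiguity.

(** * Powers of q and shifted factorials *)

Lemma Cexp_plus (z w : C) : Cexp (z + w) = (Cexp z * Cexp w)%C.
Proof.
unfold Cexp, Cmult, Re, Im; simpl. rewrite exp_plus, cos_plus, sin_plus.
f_equal; ring.
Qed.

Lemma qpow_succ (q L z : C) : Cexp L = q -> qpow L (z + 1) = (qpow L z * q)%C.
Proof.
intros HL. unfold qpow.
replace ((z + 1) * L)%C with (z * L + L)%C by ring.
now rewrite Cexp_plus, HL.
Qed.

(** Both sides equal [qfact a q (S n)], with the first or the last factor split off. *)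
Lemma qfact_contiguous (a q : C) (n : nat) :
  ((1 - a) * qfact (a * q) q n = (1 - a * q ^ n) * qfact a q n)%C.
Proof.
induction n as [|n IH]; simpl; [ring|].
rewrite Cmult_assoc, IH. ring.
Qed.

Lemma qfact_neq0 (q c : C) (n : nat) :
  0 < Cmod q < 1 -> admissible q c -> qfact c q n <> 0%C.
Proof.
intros Hq Hc. destruct (qfact_inv_bounded c q Hq Hc) as [B HB]. apply HB.
Qed.

(** Raising a numerator parameter: [X] collects the numerator factors that the shift leaves
    alone. *)
Lemma quot_contiguous_num (a q X r : C) (n : nat) :
  ((1 - a * q ^ n) * (qfact a q n * X / r)
   = (1 - a) * (qfact (a * q) q n * X / r))%C.
Proof.
unfold Cdiv. rewrite !Cmult_assoc, qfact_contiguous. ring.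
Qed.

(** Lowering a denominator parameter from [c * q] to [c]. The multiplier involves the lowered value
    [c], whence the exponents gamma - 1 and beta - 1 in the formulas. *)
Lemma quot_contiguous_den (c q X r s : C) (n : nat) :
  qfact c q n <> 0%C -> qfact (c * q) q n <> 0%C -> r <> 0%C -> s <> 0%C ->
  ((1 - c * q ^ n) * (X / (qfact (c * q) q n * r * s))
   = (1 - c) * (X / (qfact c q n * r * s)))%C.
Proof.
intros H0 H1 Hr Hs. pose proof (qfact_contiguous c q n) as E.
transitivity ((1 - c * q ^ n) * qfact c q n * X
  / (qfact c q n * qfact (c * q) q n * r * s))%C; [now field|].
rewrite <- E. now field.
Qed.

(** * Coefficients of the Humbert series and the contiguity formulas *)

Definition Phi1_coef (a b c q : C) (n k : nat) : C :=
  (qfact a q (n + k) * qfact b q n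
     / (qfact c q (n + k) * qfact q q n * qfact q q k))%C.

Definition Phi2_coef (a b c q : C) (n k : nat) : C :=
  (qfact a q n * qfact b q k
     / (qfact c q (n + k) * qfact q q n * qfact q q k))%C.

Definition Phi3_coef (a b q : C) (n k : nat) : C :=
  (qfact a q n / (qfact b q (n + k) * qfact q q n * qfact q q k))%C.

Theorem theorem2p2 (q L : C) (hq : 0 < Cmod q < 1) (hL : Cexp L = q) :
  (* (i) *)
  (forall alpha beta gamma x y : C,
     admissible q (qpow L gamma) ->
     abs_summable
       (Phi1_term (qpow L alpha) (qpow L beta) (qpow L gamma) q x y) ->
     let F := Phi1 (qpow L alpha) (qpow L beta) (qpow L gamma) q in
     (qpow L alpha * Theta_x q F x y + qnum q L alpha * F x y
        + qpow L alpha * Theta_y q (fun s t => F (q * s) t) x y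
      = qnum q L alpha
        * Phi1 (qpow L (alpha + 1)) (qpow L beta) (qpow L gamma) q x y)%C /\
     (qpow L alpha * Theta_y q F x y + qnum q L alpha * F x y
        + qpow L alpha * Theta_x q (fun s t => F s (q * t)) x y
      = qnum q L alpha
        * Phi1 (qpow L (alpha + 1)) (qpow L beta) (qpow L gamma) q x y)%C /\
     (qpow L beta * Theta_x q F x y + qnum q L beta * F x y
      = qnum q L beta
        * Phi1 (qpow L alpha) (qpow L (beta + 1)) (qpow L gamma) q x y)%C /\
     (admissible q (qpow L (gamma - 1)) ->
      (qpow L (gamma - 1) * Theta_x q F x y + qnum q L (gamma - 1) * F x y
         + qpow L (gamma - 1) * Theta_y q (fun s t => F (q * s) t) x y
       = qnum q L (gamma - 1)
         * Phi1 (qpow L alpha) (qpow L beta) (qpow L (gamma - 1)) q x y)%C /\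
      (qpow L (gamma - 1) * Theta_y q F x y + qnum q L (gamma - 1) * F x y
         + qpow L (gamma - 1) * Theta_x q (fun s t => F s (q * t)) x y
       = qnum q L (gamma - 1)
         * Phi1 (qpow L alpha) (qpow L beta) (qpow L (gamma - 1)) q x y)%C))
  /\
  (* (ii) *)
  (forall alpha beta gamma x y : C,
     admissible q (qpow L gamma) ->
     abs_summable
       (Phi2_term (qpow L alpha) (qpow L beta) (qpow L gamma) q x y) ->
     let F := Phi2 (qpow L alpha) (qpow L beta) (qpow L gamma) q in
     (qpow L alpha * Theta_x q F x y + qnum q L alpha * F x y
      = qnum q L alpha
        * Phi2 (qpow L (alpha + 1)) (qpow L beta) (qpow L gamma) q x y)%C /\
     (qpow L beta * Theta_y q F x y + qnum q L beta * F x y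
      = qnum q L beta
        * Phi2 (qpow L alpha) (qpow L (beta + 1)) (qpow L gamma) q x y)%C /\
     (admissible q (qpow L (gamma - 1)) ->
      (qpow L (gamma - 1) * Theta_x q F x y + qnum q L (gamma - 1) * F x y
         + qpow L (gamma - 1) * Theta_y q (fun s t => F (q * s) t) x y
       = qnum q L (gamma - 1)
         * Phi2 (qpow L alpha) (qpow L beta) (qpow L (gamma - 1)) q x y)%C /\
      (qpow L (gamma - 1) * Theta_y q F x y + qnum q L (gamma - 1) * F x y
         + qpow L (gamma - 1) * Theta_x q (fun s t => F s (q * t)) x y
       = qnum q L (gamma - 1)
         * Phi2 (qpow L alpha) (qpow L beta) (qpow L (gamma - 1)) q x y)%C))
  /\
  (* (iii) *)
  (forall alpha beta x y : C,
     admissible q (qpow L beta) ->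
     abs_summable (Phi3_term (qpow L alpha) (qpow L beta) q x y) ->
     let F := Phi3 (qpow L alpha) (qpow L beta) q in
     (qpow L alpha * Theta_x q F x y + qnum q L alpha * F x y
      = qnum q L alpha
        * Phi3 (qpow L (alpha + 1)) (qpow L beta) q x y)%C /\
     (admissible q (qpow L (beta - 1)) ->
      (qpow L (beta - 1) * Theta_x q F x y + qnum q L (beta - 1) * F x y
         + qpow L (beta - 1) * Theta_y q (fun s t => F (q * s) t) x y
       = qnum q L (beta - 1)
         * Phi3 (qpow L alpha) (qpow L (beta - 1)) q x y)%C /\
      (qpow L (beta - 1) * Theta_y q F x y + qnum q L (beta - 1) * F x y
         + qpow L (beta - 1) * Theta_x q (fun s t => F s (q * t)) x y
       = qnum q L (beta - 1)
         * Phi3 (qpow L alpha) (qpow L (beta - 1)) q x y)%C)).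
Proof.
pose proof (proj2 hq) as hq1.
assert (hqq : forall n, qfact q q n <> 0%C)
  by (intros n; apply qfact_neq0; [exact hq|now apply admissible_q]).
(* Writes the given denominator parameter as [c * q] with [c] the lowered one, as
   [quot_contiguous_den] expects. *)
assert (hp : forall z, qpow L z = (qpow L (z - 1) * q)%C).
{ intros z. rewrite <- (qpow_succ q L (z - 1) hL). f_equal. ring. }
assert (hn : forall c n, admissible q c -> qfact c q n <> 0%C)
  by (intros; now apply qfact_neq0).
split; [|split].
- intros alpha beta gamma x y Hadm Hs F.
  rewrite !(qpow_succ q L _ hL).
  (* [pterm] of [Phi1_coef] is convertible to [Phi1_term], and [qnum] to [(1 - a) / (1 - q)], so
     [Hs] and the conclusions fit without rewriting. *)
  assert (Hxy := contiguity_xy q (qpow L alpha) x y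
    (Phi1_coef (qpow L alpha) (qpow L beta) (qpow L gamma) q)
    (Phi1_coef (qpow L alpha * q) (qpow L beta) (qpow L gamma) q) hq1 Hs
    ltac:(intros; apply quot_contiguous_num)).
  split; [exact (proj1 Hxy)|]. split; [exact (proj2 Hxy)|]. clear Hxy.
  split.
  + apply (contiguity_x q (qpow L beta) x y
      (Phi1_coef (qpow L alpha) (qpow L beta) (qpow L gamma) q)
      (Phi1_coef (qpow L alpha) (qpow L beta * q) (qpow L gamma) q) hq1 Hs).
    intros n k. unfold Phi1_coef.
    (* Brings the factor with parameter [qpow L beta] to the front, where the shift is applied. *)
    rewrite !(Cmult_comm (qfact (qpow L alpha) q (n + k))).
    apply quot_contiguous_num.
  + intros Hadm'.
    apply (contiguity_xy q (qpow L (gamma - 1)) x y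
      (Phi1_coef (qpow L alpha) (qpow L beta) (qpow L gamma) q)
      (Phi1_coef (qpow L alpha) (qpow L beta) (qpow L (gamma - 1)) q) hq1 Hs).
    rewrite (hp gamma) in *.
    intros n k. apply quot_contiguous_den; auto.
- intros alpha beta gamma x y Hadm Hs F.
  rewrite !(qpow_succ q L _ hL).
  split; [|split].
  + apply (contiguity_x q (qpow L alpha) x y
      (Phi2_coef (qpow L alpha) (qpow L beta) (qpow L gamma) q)
      (Phi2_coef (qpow L alpha * q) (qpow L beta) (qpow L gamma) q) hq1 Hs).
    intros; apply quot_contiguous_num.
  + apply (contiguity_y q (qpow L beta) x y
      (Phi2_coef (qpow L alpha) (qpow L beta) (qpow L gamma) q)
      (Phi2_coef (qpow L alpha) (qpow L beta * q) (qpow L gamma) q) hq1 Hs).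
    intros n k. unfold Phi2_coef.
    (* Here the beta factor has index [k], hence the use of [contiguity_y]; it is moved to the
       front. *)
    rewrite !(Cmult_comm (qfact (qpow L alpha) q n)).
    apply quot_contiguous_num.
  + intros Hadm'.
    apply (contiguity_xy q (qpow L (gamma - 1)) x y
      (Phi2_coef (qpow L alpha) (qpow L beta) (qpow L gamma) q)
      (Phi2_coef (qpow L alpha) (qpow L beta) (qpow L (gamma - 1)) q) hq1 Hs).
    rewrite (hp gamma) in *.
    intros n k. apply quot_contiguous_den; auto.
- intros alpha beta x y Hadm Hs F.
  rewrite !(qpow_succ q L _ hL).
  split.
  + apply (contiguity_x q (qpow L alpha) x y
      (Phi3_coef (qpow L alpha) (qpow L beta) q)
      (Phi3_coef (qpow L alpha * q) (qpow L beta) q) hq1 Hs).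
    intros n k. unfold Phi3_coef.
    (* The numerator has a single factor, so [X = 1] is inserted to match [quot_contiguous_num]. *)
    rewrite <- (Cmult_1_r (qfact (qpow L alpha) q n)),
      <- (Cmult_1_r (qfact (qpow L alpha * q) q n)).
    apply quot_contiguous_num.
  + intros Hadm'.
    apply (contiguity_xy q (qpow L (beta - 1)) x y
      (Phi3_coef (qpow L alpha) (qpow L beta) q)
      (Phi3_coef (qpow L alpha) (qpow L (beta - 1)) q) hq1 Hs).
    rewrite (hp beta) in *.
    intros n k. apply quot_contiguous_den; auto.
Qed.
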